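(* Let $\mathcal{A}$ be an $n$-dimensional evolution algebra over a field $\mathbb{K}$ with natural basis $\mathcal{B}=\{e_1,\dots,e_n\}$ and structure matrix $\mathcal{M}_{\mathcal{B}}$ of rank $r$. Assume that $e_1^2,\dots,e_r^2$ are linearly independent and let $e_{r+i}^2=\sum_{k=1}^r c_{ki}e_k^2$ for $i\in\{1,\dots,n-r\}$, with $c_{ki}\in\mathbb{K}$. Let $d_2,d_3$ be linear maps on $\mathcal{A}$ and $\lambda_k:=d^{(2)}_{kk}+d^{(3)}_{kk}$ for $k\in\{1,\dots,n\}$. Then the matrix equation $$d_1\mathcal{M}_{\mathcal{B}}=\mathcal{M}_{\mathcal{B}}\,\mathrm{diag}(d_2+d_3)$$ has a solution for $d_1$ if and only if $c_{ji}\neq0$ implies $\lambda_j=\lambda_{r+i}$, for all $i\in\{1,\dots,n-r\}$ and $j\in\{1,\dots,r\}$.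
   Context: $\mathbb{K}$ is an arbitrary field. An $n$-dimensional evolution algebra is an $n$-dimensional vector space $\mathcal{A}$ over $\mathbb{K}$ with a bilinear product admitting a basis $\mathcal{B}=\{e_1,\dots,e_n\}$ (a natural basis) such that $e_ie_j=0$ for $i\neq j$. Writing $e_i^2=\sum_{k=1}^n w_{ki}e_k$, the structure matrix is $\mathcal{M}_{\mathcal{B}}=(w_{ki})$ (column $i$ is the coordinate vector of $e_i^2$). Linear maps are identified with their matrices with respect to $\mathcal{B}$, with $d_\ell(e_i)=\sum_{k=1}^n d^{(\ell)}_{ki}e_k$, and $\mathrm{diag}(d_2+d_3)=\mathrm{diag}(\lambda_1,\dots,\lambda_n)$ is the diagonal matrix having the same diagonal entries as $d_2+d_3$. *)

(* Defs.v *)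
From HB Require Import structures.
From mathcomp Require Import all_boot all_order all_algebra.

Set Implicit Arguments.
Unset Strict Implicit.
Unset Printing Implicit Defensive.

Import GRing.Theory.
Local Open Scope ring_scope.

(* MathComp has no nonassociative algebras, so the product of an evolution
   algebra A is carried as a bilinear map mul : A -> A -> A.  Since a basis is
   an n-tuple, "basis_of fullv e" also says that A has dimension n. *)
Definition natural_basis (K : fieldType) (A : vectType K)
    (mul : {bilinear A -> A -> A}) (n : nat) (e : n.-tuple A) : Prop :=
  basis_of fullv e /\
  (forall i j : 'I_n, i != j -> mul (tnth e i) (tnth e j) = 0).

(* Matrices act on column vectors: column i holds the coordinates of the
   square, resp. image, of e_i.  (MathComp's mxof is the transpose.) *)
Definition structure_matrix (K : fieldType) (A : vectType K)
    (mul : {bilinear A -> A -> A}) (n : nat) (e : n.-tuple A) : 'M[K]_n :=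
  \matrix_(k, i) coord e k (mul (tnth e i) (tnth e i)).

Definition matrix_of (K : fieldType) (A : vectType K) (n : nat)
    (e : n.-tuple A) (d : 'End(A)) : 'M[K]_n :=
  \matrix_(k, i) coord e k (d (tnth e i)).

Definition diag_part (K : fieldType) (n : nat) (D : 'M[K]_n) : 'M[K]_n :=
  diag_mx (\row_k D k k).

(* For r <= n, the 0-based indices of e_1, ..., e_r and of
   e_{r+1}, ..., e_n among those of e_1, ..., e_n. *)
Definition head_idx (r n : nat) (le_rn : (r <= n)%N) (j : 'I_r) : 'I_n :=
  widen_ord le_rn j.

Definition tail_idx (r n : nat) (le_rn : (r <= n)%N) (i : 'I_(n - r)) : 'I_n :=
  cast_ord (subnKC le_rn) (rshift r i).

(* Main.v *)
Require Import Defs.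
From mathcomp Require Import all_boot all_order all_algebra.

Set Implicit Arguments.
Unset Strict Implicit.
Unset Printing Implicit Defensive.

Import GRing.Theory.
Local Open Scope ring_scope.

(** Read column by column, the matrix equation says that [d1] multiplies each
    square [e_k^2] by [lambda_k] ([matrix_eqP]).  On [e_1^2, ..., e_r^2] this can
    always be achieved, since a linear map may take any values on a free family
    ([free_extension]), and the values on the other squares then follow.  Applying
    [d1] to [e_(r+i)^2 = \sum_k c_ki *: e_k^2] gives
    [\sum_k (c_ki * lambda_k) *: e_k^2], whereas the equation asks for
    [\sum_k (c_ki * lambda_(r+i)) *: e_k^2].  By freeness these agree exactly when
    [lambda_k = lambda_(r+i)] wherever [c_ki] is nonzero
    ([eigen_combinationP]). *)

Lemma head_tail_ind (n r : nat) (le_rn : (r <= n)%N) (P : 'I_n -> Prop) :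
  (forall j, P (head_idx le_rn j)) -> (forall i, P (tail_idx le_rn i)) ->
  forall k, P k.
Proof.
move=> Phead Ptail k.
rewrite -[k](cast_ordKV (subnKC le_rn)).
case: (split_ordP (cast_ord (esym (subnKC le_rn)) k)) => j ->.
  suff -> : cast_ord (subnKC le_rn) (lshift (n - r) j) = head_idx le_rn j by [].
  exact: val_inj.
exact: Ptail.
Qed.

Section LinearMaps.

Variables (K : fieldType) (A : vectType K).

Lemma free_extension (m : nat) (X Y : m.-tuple A) :
  free X -> exists f : 'End(A), forall k, f (tnth X k) = tnth Y k.
Proof.
move=> freeX; have [f fXY] := linear_of_free X Y.
have /= map_fXY : map f X = Y by apply: fXY; rewrite ?size_tuple.
have -> : Y = map_tuple f X by exact: val_inj.
by exists (linfun f) => k; rewrite lfunE tnth_map.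
Qed.

(** The difference of the two vectors has coefficients [a k * (l k - mu)] on the
    free family [X], so it vanishes exactly when all of these do. *)
Lemma eigen_combinationP (m : nat) (X : m.-tuple A) (f : 'End(A))
    (l a : 'I_m -> K) (mu : K) :
  free X -> (forall k, f (tnth X k) = l k *: tnth X k) ->
  f (\sum_k a k *: tnth X k) = mu *: (\sum_k a k *: tnth X k)
  <-> (forall k, a k != 0 -> l k = mu).
Proof.
move=> freeX eigX.
have fE : f (\sum_k a k *: tnth X k) = \sum_k (a k * l k) *: tnth X k.
  by rewrite linear_sum; apply: eq_bigr => k _; rewrite linearZ /= eigX scalerA.
rewrite fE scaler_sumr; split=> [/eqP | lmu].
  rewrite -subr_eq0 -sumrB => /eqP sum0 k ak_neq0.
  have /eqP : a k * (l k - mu) = 0.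
    apply: (freeP freeX (fun j => a j * (l j - mu))).
    rewrite -[RHS]sum0; apply: eq_bigr => j _.
    by rewrite -tnth_nth scalerA -scalerBl mulrBr [mu * _]mulrC.
  by rewrite mulf_eq0 (negPf ak_neq0) subr_eq0 => /eqP.
apply: eq_bigr => k _; rewrite scalerA mulrC.
by have [-> | /lmu ->] := eqVneq (a k) 0; rewrite ?mulr0 ?mul0r.
Qed.

Variables (n : nat) (e : n.-tuple A).

Lemma coord_basis_inj (u v : A) :
  basis_of fullv e -> (forall k, coord e k u = coord e k v) -> u = v.
Proof.
move=> basis_e eq_uv.
rewrite (coord_basis basis_e (memvf u)) (coord_basis basis_e (memvf v)).
by apply: eq_bigr => k _; rewrite eq_uv.
Qed.

Lemma matrix_of_mul_coord (d : 'End(A)) (u : A) (k : 'I_n) :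
  basis_of fullv e ->
  \sum_j matrix_of e d k j * coord e j u = coord e k (d u).
Proof.
move=> basis_e; rewrite {2}(coord_basis basis_e (memvf u)) !linear_sum /=.
by apply: eq_bigr => j _; rewrite mxE !linearZ /= -tnth_nth mulrC.
Qed.

(** Both sides are compared through the coordinates of column [i]: on the left
    they are those of [d1 (e_i^2)], because [matrix_of e d1] acts on coordinate
    columns as [d1] does on vectors; on the right the diagonal matrix scales the
    column of [e_i^2]. *)
Lemma matrix_eqP (mul : {bilinear A -> A -> A}) (d1 d2 d3 : 'End(A)) :
  basis_of fullv e ->
  matrix_of e d1 *m structure_matrix mul e
    = structure_matrix mul e *m diag_part (matrix_of e (d2 + d3))
  <-> (forall i, let sq := mul (tnth e i) (tnth e i) in
       d1 sq = (matrix_of e d2 i i + matrix_of e d3 i i) *: sq).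
Proof.
move=> basis_e; set M := structure_matrix mul e.
have lhsE k i : (matrix_of e d1 *m M) k i
    = coord e k (d1 (mul (tnth e i) (tnth e i))).
  rewrite -matrix_of_mul_coord // mxE.
  by apply: eq_bigr => j _; rewrite [M _ _]mxE.
have rhsE k i : (M *m diag_part (matrix_of e (d2 + d3))) k i
    = coord e k ((matrix_of e d2 i i + matrix_of e d3 i i)
                   *: mul (tnth e i) (tnth e i)).
  rewrite /diag_part mul_mx_diag !mxE add_lfunE linearD linearZ /=.
  exact: mulrC.
split=> [/matrixP eqM i | eigsq].
  by apply: coord_basis_inj => // k; rewrite -lhsE -rhsE eqM.
by apply/matrixP => k i; rewrite lhsE rhsE eigsq.
Qed.

End LinearMaps.

Theorem proposition4p7 (K : fieldType) (A : vectType K)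
    (mul : {bilinear A -> A -> A}) (n r : nat) (e : n.-tuple A)
    (le_rn : (r <= n)%N) (c : 'I_r -> 'I_(n - r) -> K) (d2 d3 : 'End(A)) :
  let sq (k : 'I_n) := mul (tnth e k) (tnth e k) in
  let M := structure_matrix mul e in
  let lambda (k : 'I_n) := matrix_of e d2 k k + matrix_of e d3 k k in
  natural_basis mul e ->
  \rank M = r ->
  free [tuple sq (head_idx le_rn k) | k < r] ->
  (forall i : 'I_(n - r),
     sq (tail_idx le_rn i) = \sum_(k < r) c k i *: sq (head_idx le_rn k)) ->
  (exists d1 : 'End(A),
     matrix_of e d1 *m M = M *m diag_part (matrix_of e (d2 + d3)))
  <->
  (forall (i : 'I_(n - r)) (j : 'I_r),
     c j i != 0 -> lambda (head_idx le_rn j) = lambda (tail_idx le_rn i)).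
Proof.
move=> sq M lambda [basis_e _] _ freeX tailE.
set X := [tuple _ | _ < _] in freeX.
have XE k : tnth X k = sq (head_idx le_rn k) by rewrite tnth_mktuple.
have tailX i : sq (tail_idx le_rn i) = \sum_k c k i *: tnth X k.
  by rewrite tailE; apply: eq_bigr => k _; rewrite XE.
split=> [[d1 /(matrix_eqP mul d1 d2 d3 basis_e) eigsq] i | eq_lambda].
  have eigX k : d1 (tnth X k) = lambda (head_idx le_rn k) *: tnth X k.
    by rewrite XE; exact: eigsq.
  apply/(eigen_combinationP (c^~ i) _ freeX eigX).
  by rewrite -tailX; exact: eigsq.
have [d1 d1X] := free_extension
  [tuple lambda (head_idx le_rn k) *: tnth X k | k < r] freeX.
have eigX k : d1 (tnth X k) = lambda (head_idx le_rn k) *: tnth X k.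
  by rewrite d1X tnth_mktuple.
exists d1; apply/(matrix_eqP mul d1 d2 d3 basis_e).
apply: (head_tail_ind (le_rn := le_rn)) => [j | i] /=.
  by rewrite -[mul _ _]/(sq _) -XE eigX.
rewrite -[mul _ _]/(sq _) tailX.
by apply/(eigen_combinationP _ _ freeX eigX) => k; exact: eq_lambda.
Qed.
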